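(* Let $a>0$ and suppose that $\psi_a(\cdot,y)$ is a convex function on $X$ for every $y\in X$. Then the set of normalized Nash equilibria $X^*\subseteq X$ (assumed non-empty) fulfills the weak sharpness property if and only if $\psi_a$ is linearly conditioned.
   Context: Setting (jointly convex generalized Nash equilibrium problem). There are $N$ players; player $i$ controls $x_i\in\mathbb{R}^{n_i}$, with $\sum_{i=1}^N n_i=n$, and $x=(x_1,\dots,x_N)=(x_{-i},x_i)\in\mathbb{R}^n$, where $x_{-i}\in\mathbb{R}^{n-n_i}$ collects the strategies of all players other than $i$. Given $x_{-i}$, player $i$ minimizes $\theta_i(x_{-i},\cdot)$ over $K_i(x_{-i})=\{x_i\in\mathbb{R}^{n_i} : (x_{-i},x_i)\in X\}$. Standing assumptions: (A1) $X\subseteq\mathbb{R}^n$ is non-empty, closed and convex; (A2) for each $i$, the loss function $\theta_i:\mathbb{R}^{n-n_i}\times\mathbb{R}^{n_i}\to\mathbb{R}$ is continuously differentiable, and $\theta_i(x_{-i},\cdot)$ is convex for each $x_{-i}\in\mathbb{R}^{n-n_i}$. Define $F:\mathbb{R}^n\to\mathbb{R}^n$ by $F(x)=(\nabla_{x_1}\theta_1(x),\dots,\nabla_{x_N}\theta_N(x))$, where $\nabla_{x_i}$ is the partial gradient with respect to $x_i$. A normalized Nash equilibrium (NNE) is a point $x^*\in X$ with $\langle F(x^* ),y-x^*\rangle\ge 0$ for all $y\in X$; $X^*$ denotes the set of all NNE. For $a>0$, the regularized Nikaido-Isoda function $\psi_a:X\times X\to\mathbb{R}$ is $$\psi_a(x,y)=\sum_{i=1}^N\Big[\theta_i(x_{-i},x_i)-\theta_i(x_{-i},y_i)-\tfrac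 a2\|x_i-y_i\|^2\Big].$$ For a set $S\subseteq\mathbb{R}^n$, $S^\circ=\{v : \langle v,z\rangle\le 0\ \forall z\in S\}$ is its polar; for a closed convex set $S$ and $x\in S$, the normal cone is $N_S(x)=(S-x)^\circ=\{v:\langle v,z-x\rangle\le 0\ \forall z\in S\}$ and the tangent cone is $T_S(x)=[N_S(x)]^\circ$. $B$ is the (closed) unit ball of $\mathbb{R}^n$, $\|\cdot\|$ is the Euclidean norm, $d(x,S)=\inf_{z\in S}\|x-z\|$, and for $S$ non-empty, closed and convex $P_S(x)$ is the Euclidean projection of $x$ onto $S$. (Under the convexity hypothesis on $\psi_a$, the set $X^*$ is closed and convex.) Weak sharpness property: $X^*$ fulfills the weak sharpness property if there exists $\gamma>0$ such that $$-F(x^* )+\gamma B\ \subseteq\ \bigcap_{x\in X^*}\big[T_X(x)\cap N_{X^*}(x)\big]^\circ\quad\text{for all }x^*\in X^* .$$ Linear conditioning: $\psi_a$ is linearly conditioned if there exists $\gamma>0$ such that $\psi_a(x,P_{X^*}(x))\ge\gamma\, d(x,X^* )$ for all $x\in X$. *)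

(* Defs.v *)
From HB Require Import structures.
From mathcomp Require Import all_boot all_order all_algebra.
From mathcomp Require Import all_classical all_reals all_analysis.

Set Implicit Arguments.
Unset Strict Implicit.
Unset Printing Implicit Defensive.

Import Order.TTheory GRing.Theory Num.Theory.
Import numFieldNormedType.Exports.

Local Open Scope classical_set_scope.
Local Open Scope ring_scope.

(* The library norm `|x| on 'rV[R]_m is the maximum norm, hence a separate
   Euclidean inner product and norm.  The topologies, and therefore [closed],
   [differentiable] and [continuous], agree. *)
Definition dot (R : realType) (m : nat) (u v : 'rV[R]_m) : R :=
  \sum_(k < m) u 0 k * v 0 k.

Definition enorm (R : realType) (m : nat) (u : 'rV[R]_m) : R :=
  Num.sqrt (dot u u).

Definition unit_ball (R : realType) (m : nat) : set 'rV[R]_m :=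
  [set u | enorm u <= 1].
Arguments unit_ball {R m}.

Definition polar (R : realType) (m : nat) (S : set 'rV[R]_m) : set 'rV[R]_m :=
  [set v | forall z, S z -> dot v z <= 0].

Definition normal_cone (R : realType) (m : nat) (S : set 'rV[R]_m)
    (x : 'rV[R]_m) : set 'rV[R]_m :=
  polar [set z - x | z in S].

Definition tangent_cone (R : realType) (m : nat) (S : set 'rV[R]_m)
    (x : 'rV[R]_m) : set 'rV[R]_m :=
  polar (normal_cone S x).

Definition dist (R : realType) (m : nat) (x : 'rV[R]_m) (S : set 'rV[R]_m) : R :=
  inf [set enorm (x - z) | z in S].

(* The default value [x] of [xget] is irrelevant when [S] is non-empty, closed
   and convex: the nearest point then exists and is unique. *)
Definition proj (R : realType) (m : nat) (S : set 'rV[R]_m) (x : 'rV[R]_m) :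
    'rV[R]_m :=
  xget x [set z | S z /\ forall w, S w -> enorm (x - z) <= enorm (x - w)].

Definition grad (R : realType) (m : nat) (f : 'rV[R]_m -> R) (x : 'rV[R]_m) :
    'rV[R]_m :=
  \row_(k < m) 'D_(delta_mx 0 k) f x.

Definition continuously_differentiable (R : realType) (m : nat)
    (f : 'rV[R]_m -> R) : Prop :=
  (forall x, differentiable f x) /\ continuous (grad f).

(* A strategy profile x = (x_1, ..., x_N) is a row vector of width
   \sum_i n i, with i-th block [submxrow x i].  A loss function of player i is
   a function of the whole profile, and theta_i (x_{-i}, z) is
   [theta i (with_strategy x z)]. *)
Definition with_strategy (R : realType) (N : nat) (n : 'I_N -> nat)
    (x : 'rV[R]_(\sum_(i < N) n i)) (i : 'I_N) (z : 'rV[R]_(n i)) :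
    'rV[R]_(\sum_(i < N) n i) :=
  \mxrow_(j < N) eqtype.dfwith (fun j : 'I_N => submxrow x j) z j.

Definition partial_grad (R : realType) (N : nat) (n : 'I_N -> nat) (i : 'I_N)
    (f : 'rV[R]_(\sum_(i < N) n i) -> R) (x : 'rV[R]_(\sum_(i < N) n i)) :
    'rV[R]_(n i) :=
  grad (fun z : 'rV[R]_(n i) => f (with_strategy x z)) (submxrow x i).

Definition pseudo_gradient (R : realType) (N : nat) (n : 'I_N -> nat)
    (theta : 'I_N -> 'rV[R]_(\sum_(i < N) n i) -> R)
    (x : 'rV[R]_(\sum_(i < N) n i)) : 'rV[R]_(\sum_(i < N) n i) :=
  \mxrow_(i < N) partial_grad i (theta i) x.

Definition NNE (R : realType) (N : nat) (n : 'I_N -> nat)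
    (theta : 'I_N -> 'rV[R]_(\sum_(i < N) n i) -> R)
    (X : set 'rV[R]_(\sum_(i < N) n i)) : set 'rV[R]_(\sum_(i < N) n i) :=
  [set x | X x /\
    forall y, X y -> 0 <= dot (pseudo_gradient theta x) (y - x)].

Definition psi (R : realType) (N : nat) (n : 'I_N -> nat)
    (theta : 'I_N -> 'rV[R]_(\sum_(i < N) n i) -> R) (a : R)
    (x y : 'rV[R]_(\sum_(i < N) n i)) : R :=
  \sum_(i < N) (theta i x - theta i (with_strategy x (submxrow y i))
                - a / 2 * enorm (submxrow x i - submxrow y i) ^+ 2).

Definition weakly_sharp (R : realType) (N : nat) (n : 'I_N -> nat)
    (theta : 'I_N -> 'rV[R]_(\sum_(i < N) n i) -> R)
    (X : set 'rV[R]_(\sum_(i < N) n i)) : Prop :=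
  exists2 gamma : R, 0 < gamma &
    forall xs, NNE theta X xs ->
      [set - pseudo_gradient theta xs + gamma *: b | b in unit_ball] `<=`
      \bigcap_(x in NNE theta X)
        polar (tangent_cone X x `&` normal_cone (NNE theta X) x).

Definition linearly_conditioned (R : realType) (N : nat) (n : 'I_N -> nat)
    (theta : 'I_N -> 'rV[R]_(\sum_(i < N) n i) -> R)
    (X : set 'rV[R]_(\sum_(i < N) n i)) (a : R) : Prop :=
  exists2 gamma : R, 0 < gamma &
    forall x, X x ->
      gamma * dist x (NNE theta X) <= psi theta a x (proj (NNE theta X) x).

(* Main.v *)
Require Import Defs.
From HB Require Import structures.
From mathcomp Require Import all_boot all_order all_algebra.
From mathcomp Require Import all_classical all_reals all_analysis.
From mathcomp Require Import ring lra.

Set Implicit Arguments.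
Unset Strict Implicit.
Unset Printing Implicit Defensive.

Import Order.TTheory GRing.Theory Num.Theory.
Import numFieldNormedType.Exports.

Local Open Scope classical_set_scope.
Local Open Scope ring_scope.
(** The weight a forces the set of equilibria to be a single point, and at a
    single point both properties become one and the same growth inequality.

    Write psi for psi_a and F for the pseudo-gradient.  For x and y in X,

      <F(y), x - y> <= psi(x, y) <= <F(x), x - y> - a/2 |x - y|^2.

    The lower bound ([dot_le_psi]) is the tangent inequality at y for the
    convex function psi(., y): it vanishes at y, and its gradient there is
    F(y), since differentiating theta_i(x) - theta_i(x_{-i}, y_i) at x = y
    cancels every block of the gradient of theta_i but the i-th one
    ([is_derive_psi]).  The upper bound ([psi_le_dot]) is the tangent
    inequality at x_i for each theta_i(x_{-i}, .), summed over the players.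

    If x and y are both equilibria, then <F(y), x - y> >= 0 >= <F(x), x - y>,
    and the two bounds squeeze a/2 |x - y|^2 below zero: the equilibrium is
    unique ([NNE_unique]).  Call it p.  The normal cone of {p} at p is the
    whole space, so weak sharpness says that -F(p) + gamma B lies in the polar
    of T_X(p), which amounts to gamma |x - p| <= <F(p), x - p> on X
    ([weakly_sharpP]), while linear conditioning says that
    gamma |x - p| <= psi(x, p) on X ([linearly_conditionedP]).  The lower
    bound turns the first inequality into the second; conversely, dividing
    the second one, taken at p + t (x - p), by t and letting t tend to 0 gives
    the first one, with the same gamma ([growth_dot_psi]). *)

(** * Euclidean inner product and norm *)

Section InnerProduct.
Context {R : realType} {m : nat}.
Implicit Types (u v w : 'rV[R]_m) (c : R).

Lemma dotC u v : dot u v = dot v u.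
Proof. by apply: eq_bigr => k _; rewrite mulrC. Qed.

Lemma dotDl u v w : dot (u + v) w = dot u w + dot v w.
Proof. by rewrite -big_split; apply: eq_bigr => k _; rewrite mxE mulrDl. Qed.

Lemma dotZl c u w : dot (c *: u) w = c * dot u w.
Proof. by rewrite mulr_sumr; apply: eq_bigr => k _; rewrite mxE mulrA. Qed.

Lemma dotNl u w : dot (- u) w = - dot u w.
Proof. by rewrite -scaleN1r dotZl mulN1r. Qed.

Lemma dotBl u v w : dot (u - v) w = dot u w - dot v w.
Proof. by rewrite dotDl dotNl. Qed.

Lemma dotDr u v w : dot u (v + w) = dot u v + dot u w.
Proof. by rewrite !(dotC u) dotDl. Qed.

Lemma dotZr c u w : dot u (c *: w) = c * dot u w.
Proof. by rewrite !(dotC u) dotZl. Qed.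

Lemma dotNr u w : dot u (- w) = - dot u w.
Proof. by rewrite !(dotC u) dotNl. Qed.

Lemma dotBr u v w : dot u (v - w) = dot u v - dot u w.
Proof. by rewrite dotDr dotNr. Qed.

Lemma dot0l u : dot 0 u = 0.
Proof. by apply: big1 => k _; rewrite mxE mul0r. Qed.

Lemma dot0r u : dot u 0 = 0.
Proof. by rewrite dotC dot0l. Qed.

Lemma dotvv_ge0 u : 0 <= dot u u.
Proof. by apply: sumr_ge0 => k _; rewrite -expr2 sqr_ge0. Qed.

Lemma dotvv_eq0 u : dot u u = 0 -> u = 0.
Proof.
move=> /eqP; rewrite psumr_eq0 => [/allP u0|k _]; last first.
  by rewrite -expr2 sqr_ge0.
apply/rowP => k; have := u0 k (mem_index_enum k).
by rewrite -expr2 sqrf_eq0 mxE => /eqP.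
Qed.

Lemma enorm_ge0 u : 0 <= enorm u.
Proof. exact: sqrtr_ge0. Qed.

Lemma enorm_sqr u : enorm u ^+ 2 = dot u u.
Proof. exact/sqr_sqrtr/dotvv_ge0. Qed.

Lemma enorm_eq0 u : enorm u = 0 -> u = 0.
Proof. by move=> u0; apply: dotvv_eq0; rewrite -enorm_sqr u0 expr0n. Qed.

Lemma enormZ c u : 0 <= c -> enorm (c *: u) = c * enorm u.
Proof.
move=> c0; rewrite /enorm dotZl dotZr mulrA -expr2 sqrtrM ?sqr_ge0//.
by rewrite sqrtr_sqr ger0_norm.
Qed.

(** Cauchy-Schwarz: when neither vector is null, expand the squared norm of
    [enorm v *: u - enorm u *: v] and divide by [enorm u * enorm v]. *)
Lemma dot_le_enorm u v : dot u v <= enorm u * enorm v.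
Proof.
have [uv0|uv0] := leP (enorm u * enorm v) 0.
  have : enorm u * enorm v == 0 by rewrite eq_le uv0 mulr_ge0 ?enorm_ge0.
  rewrite mulf_eq0 => /orP[] /eqP /enorm_eq0 ->.
    by rewrite dot0l mulr_ge0 ?enorm_ge0.
  by rewrite dot0r mulr_ge0 ?enorm_ge0.
have := dotvv_ge0 (enorm v *: u - enorm u *: v).
rewrite dotBl !dotBr !dotZl !dotZr (dotC v u) -!enorm_sqr => h.
by rewrite -(ler_pM2l uv0); nra.
Qed.

End InnerProduct.

(** * One-sided slopes and directional derivatives *)

Section Derivatives.
Context {R : realType}.

(** A directional derivative only depends on the values along one line, so it
    can be transported between functions on different spaces; this replaces
    the chain rule for affine substitutions. *)
Lemma eq_line_is_derive {V V' : normedModType R} (f : V -> R) (g : V' -> R)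
    (x v : V) (y w : V') (l : R) :
  (forall t : R, f (t *: v + x) = g (t *: w + y)) ->
  is_derive y w g l -> is_derive x v f l.
Proof.
move=> fg [dg gl].
have E : (fun h : R => h^-1 *: ((f \o shift x) (h *: v) - f x)) =
         (fun h => h^-1 *: ((g \o shift y) (h *: w) - g y)).
  apply/funext => h /=; rewrite fg.
  by have := fg 0; rewrite !scale0r !add0r => ->.
by split; [rewrite /derivable E|rewrite /derive E].
Qed.

(** The difference quotients for positive steps are at most [c], and the
    two-sided derivative is also their limit from the right. *)
Lemma is_derive_le {V : normedModType R} (f : V -> R) (x v : V) (l c : R) :
  is_derive x v f l ->
  (forall t : R, 0 < t -> t <= 1 -> f (t *: v + x) <= f x + t * c) -> l <= c.
Proof.
move=> [df <-] fc; have /cvg_dnbhs_at_right/cvgr_to_le := df; apply.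
near=> t; have t0 : 0 < t by near: t; exact: nbhs_right_gt.
rewrite /= /shift /= -[_ *: _]/(_ * _) mulrC ler_pdivrMr// lerBlDl mulrC fc//.
by near: t; exact: nbhs_right_le.
Unshelve. all: by end_near. Qed.

(** Along the segment from [x] to [y] a convex function stays below its chord,
    whose slope is [f y - f x]. *)
Lemma convex_derive_le {V : normedModType R} (D : set V) (f : V -> R) (x y : V)
    (l : R) :
  convex_function D f -> D x -> D y -> is_derive x (y - x) f l ->
  l <= f y - f x.
Proof.
move=> cf Dx Dy /is_derive_le; apply=> t t0 t1.
have h : f (t *: y + (1 - t) *: x) <= t * f y + (1 - t) * f x.
  exact: cf (Itv01 (ltW t0) t1) _ _ (mem_set Dy) (mem_set Dx).
have -> : t *: (y - x) + x = t *: y + (1 - t) *: x.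
  by rewrite scalerBr scalerBl scale1r addrAC addrA.
by apply: (le_trans h); lra.
Qed.

Lemma differentiable_is_derive {V : normedModType R} (f : V -> R) (x v : V) :
  differentiable f x -> is_derive x v f ('D_v f x).
Proof. by move=> /(@diff_derivable _ _ _ _ _ v) ?; split. Qed.

End Derivatives.

(** * Strategy profiles and their blocks *)

Section Blocks.
Context {R : realType} {N : nat} {n : 'I_N -> nat}.
Implicit Types (x y d : 'rV[R]_(\sum_(i < N) n i)).

Lemma submxrowZ (c : R) x i : submxrow (c *: x) i = c *: submxrow x i.
Proof. by apply/rowP => k; rewrite !mxE. Qed.

(** The linear part of the affine map [with_strategy x]: partial gradients
    become derivatives of the whole profile function in directions [block w]. *)
Definition block (i : 'I_N) (w : 'rV[R]_(n i)) : 'rV[R]_(\sum_(i < N) n i) :=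
  with_strategy 0 w.

Lemma with_strategyE x i (z : 'rV[R]_(n i)) :
  with_strategy x z = x + block (z - submxrow x i).
Proof.
apply/mxrowP => j; rewrite submxrowD /block /with_strategy !mxrowK.
case: (eqVneq i j) => [<-|ij]; first by rewrite !dfwith_in addrC subrK.
by rewrite !dfwith_out// submxrow0 addr0.
Qed.

Lemma block_linear i : linear (@block i).
Proof.
move=> c u v; apply/mxrowP => j.
rewrite submxrowD /block /with_strategy !mxrowK.
case: (eqVneq i j) => [ij|ij].
  by case: _ / ij; rewrite submxrowZ mxrowK !dfwith_in.
rewrite !dfwith_out// submxrowZ mxrowK dfwith_out//.
by rewrite !submxrow0 scaler0 addr0.
Qed.

HB.instance Definition _ i :=
  GRing.isLinear.Build R _ _ _ (@block i) (@block_linear i).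

Lemma dot_sum_blocks x y :
  dot x y = \sum_(i < N) dot (submxrow x i) (submxrow y i).
Proof.
have E k (u v : 'rV[R]_k) : dot u v = (u *m v^T) 0 0.
  by rewrite mxE; apply: eq_bigr => j _; rewrite mxE.
rewrite E -{1}(submxrowK x) -{1}(submxrowK y) tr_mxrow mul_mxrow_mxcol summxE.
by apply: eq_bigr => i _; rewrite E.
Qed.

(** Varying only the strategy of player [i] is moving in the direction
    [block w]. *)
Lemma dot_partial_grad i (f : 'rV[R]_(\sum_(i < N) n i) -> R) x
    (w : 'rV[R]_(n i)) :
  differentiable f x -> dot (partial_grad i f x) w = 'D_(block w) f x.
Proof.
move=> df; rewrite deriveE// {2}[w]row_sum_delta !linear_sum.
apply: eq_bigr => k _; rewrite !linearZ mxE /= mulrC -deriveE//; congr *%R.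
apply: derive_val.
have Df := differentiable_is_derive (block (delta_mx 0 k)) df.
apply: eq_line_is_derive Df.
by move=> t; rewrite with_strategyE addrK linearZ addrC.
Qed.
End Blocks.

(** * Bounds on the regularized Nikaido-Isoda function *)

Section Game.
Context {R : realType} {N : nat} {n : 'I_N -> nat}.
Context {X : set 'rV[R]_(\sum_(i < N) n i)}
  {theta : 'I_N -> 'rV[R]_(\sum_(i < N) n i) -> R} {a : R}
  (theta_diff : forall i x, differentiable (theta i) x)
  (theta_convex : forall i x,
    convex_function setT (fun z : 'rV[R]_(n i) => theta i (with_strategy x z)))
  (a_gt0 : 0 < a)
  (X_convex : convex_set X)
  (psi_convex : forall y, X y ->
    convex_function X (fun x => psi theta a x y)).
Implicit Types (x y d : 'rV[R]_(\sum_(i < N) n i)).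

Local Notation F := (pseudo_gradient theta).

Lemma dot_pseudo_gradient x d :
  dot (F x) d = \sum_(i < N) 'D_(block (submxrow d i)) (theta i) x.
Proof.
rewrite dot_sum_blocks; apply: eq_bigr => i _.
by rewrite mxrowK dot_partial_grad.
Qed.

Lemma with_strategy_id x i : with_strategy x (submxrow x i) = x.
Proof. by rewrite with_strategyE subrr linear0 addr0. Qed.

Lemma psixx x : psi theta a x x = 0.
Proof.
rewrite /psi big1// => i _.
by rewrite with_strategy_id !subrr enorm_sqr dot0l mulr0 subr0.
Qed.

(** Each [theta i] lies, as a function of player [i]'s own strategy, above its
    tangent at [submxrow x i]; the quadratic penalties add up to the full
    squared distance. *)
Lemma psi_le_dot x y :
  psi theta a x y <= dot (F x) (x - y) - a / 2 * enorm (x - y) ^+ 2.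
Proof.
rewrite dot_pseudo_gradient enorm_sqr dot_sum_blocks mulr_sumr -sumrB.
apply: ler_sum => i _.
have -> : 'D_(block (submxrow (x - y) i)) (theta i) x =
    - 'D_(block (submxrow y i - submxrow x i)) (theta i) x.
  by rewrite submxrowB -opprB !deriveE// [block _]linearN linearN.
rewrite -submxrowB enorm_sqr lerB// -lerN2 opprB opprK.
rewrite -[X in _ - theta i X](with_strategy_id x i).
apply: (convex_derive_le (@theta_convex i x)) => //.
have Df := differentiable_is_derive (block (submxrow y i - submxrow x i))
  (theta_diff i x).
apply: eq_line_is_derive Df.
by move=> t; rewrite with_strategyE addrK linearZ addrC.
Qed.

(** Near [y], the [i]-th term involves [theta i] along [d] and along [d] with
    its [i]-th block removed; by linearity the difference of the two
    derivatives is the derivative along that block.  The penalty is quadratic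
    in the displacement and contributes nothing. *)
Lemma is_derive_psi y d :
  is_derive y d (fun x => psi theta a x y) (dot (F y) d).
Proof.
pose d' i := d - block (submxrow d i).
pose c i := a / 2 * dot (submxrow d i) (submxrow d i).
pose g (i : 'I_N) : R -> R :=
  (fun t => theta i (t *: d + y)) - (fun t => theta i (t *: d' i + y))
  - (c i *: ((@id R) ^+ 2)).
have Dg i : is_derive (0 : R) 1 (g i) ('D_(block (submxrow d i)) (theta i) y).
  have line e : is_derive (0 : R) 1 (fun t : R => theta i (t *: e + y))
      ('D_e (theta i) y).
    have De := differentiable_is_derive e (theta_diff i y).
    by apply: eq_line_is_derive De => t; rewrite -[_ *: 1]/(_ * 1) mulr1 addr0.
  have H := is_deriveB (is_deriveB (line d) (line (d' i)))
    (is_deriveZ (c i) (is_deriveX 2 (is_derive_id (0 : R) 1))).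
  apply: (is_derive_eq H).
  rewrite /d' !deriveE// linearB /=.
  rewrite expr1 mulr0 scale0r scaler0 subr0.
  by rewrite opprB addrC subrK.
rewrite dot_pseudo_gradient; apply: eq_line_is_derive (is_derive_sum Dg).
move=> t; rewrite fct_sumE; apply: eq_bigr => i _.
have E : submxrow (t *: d + y) i - submxrow y i = t *: submxrow d i.
  by rewrite submxrowD addrK submxrowZ.
rewrite with_strategyE enorm_sqr E -[submxrow y i - _]opprB E.
rewrite -scaleNr linearZ /= -[_ *: 1]/(_ * 1) mulr1 addr0.
rewrite /g /d' /c -[RHS]/(theta i (t *: d + y) - _ - _ * t ^+ 2).
rewrite [t *: (d - _)]scalerBr scaleNr [t *: d + y - _]addrAC dotZl dotZr; ring.
Qed.

(** The tangent inequality at [y] for [psi theta a ^~ y], which vanishes at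
    [y]. *)
Lemma dot_le_psi x y : X x -> X y -> dot (F y) (x - y) <= psi theta a x y.
Proof.
move=> Xx Xy.
have := convex_derive_le (psi_convex Xy) Xy Xx (is_derive_psi _ _).
by rewrite psixx subr0.
Qed.

(** * Uniqueness of the equilibrium and its consequences *)

(** Together, the bounds make the pseudo-gradient strongly monotone with
    modulus [a / 2], and a strongly monotone variational inequality has at
    most one solution. *)
Lemma NNE_unique x y : NNE theta X x -> NNE theta X y -> x = y.
Proof.
move=> [Xx Fx] [Xy Fy]; have := le_trans (dot_le_psi Xx Xy) (psi_le_dot x y).
have := Fx _ Xy; have := Fy _ Xx; rewrite -(opprB x y) dotNr => h1 h2 h3.
apply/eqP; rewrite -subr_eq0; apply/eqP/enorm_eq0/eqP.
by rewrite -sqrf_eq0 eq_le sqr_ge0 andbT -(pmulr_rle0 _ a_gt0); lra.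
Qed.

Lemma NNE_set1 xs : NNE theta X xs -> NNE theta X = [set xs].
Proof.
by move=> h; apply/seteqP; split=> [x Nx|x ->//]; exact: NNE_unique.
Qed.

(** With a single equilibrium [xs] the cone [normal_cone (NNE theta X) xs] is
    everything.  Forward, [x - xs] is a tangent direction, tested against the
    unit vector pointing along it.  Backward, Cauchy-Schwarz puts
    [- F xs + g *: b] in the normal cone of [X], whose polar is by definition
    the tangent cone. *)
Lemma weakly_sharpP xs : NNE theta X xs ->
  weakly_sharp theta X <->
  exists2 g, 0 < g & forall x, X x -> g * enorm (x - xs) <= dot (F xs) (x - xs).
Proof.
move=> Nxs; rewrite /weakly_sharp (NNE_set1 Nxs).
split=> -[g g0 h]; exists g => //.
- move=> x Xx; have [e0|e0] := eqVneq (enorm (x - xs)) 0.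
    by rewrite e0 (enorm_eq0 e0) dot0r mulr0.
  have ep : 0 < enorm (x - xs) by rewrite lt_neqAle eq_sym e0 enorm_ge0.
  have : dot (- F xs + g *: ((enorm (x - xs))^-1 *: (x - xs))) (x - xs) <= 0.
    apply: (h xs erefl _ _ xs erefl).
      exists ((enorm (x - xs))^-1 *: (x - xs)) => //.
      by rewrite /unit_ball /= enormZ ?invr_ge0 ?enorm_ge0// mulVf.
    split=> [v vN|_ [_ -> <-]]; first by rewrite dotC; apply: vN; exists x.
    by rewrite subrr dot0r.
  rewrite dotDl dotNl !dotZl -enorm_sqr expr2 mulKf//; lra.
- move=> x -> _ [b b1 <-] _ -> v [vT _]; rewrite dotC; apply: vT => _ [z Xz <-].
  rewrite dotDl dotNl dotZl.
  have := h _ Xz; have := dot_le_enorm b (z - xs).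
  have := enorm_ge0 (z - xs); rewrite /unit_ball /= in b1 => h1 h2 h3.
  have : dot b (z - xs) <= enorm (z - xs).
    by apply: (le_trans h2); rewrite ler_piMl.
  by rewrite -(ler_pM2l g0); lra.
Qed.

Lemma linearly_conditionedP xs : NNE theta X xs ->
  linearly_conditioned theta X a <->
  exists2 g, 0 < g & forall x, X x -> g * enorm (x - xs) <= psi theta a x xs.
Proof.
move=> Nxs; rewrite /linearly_conditioned (NNE_set1 Nxs).
have E x : Defs.proj [set xs] x = xs.
  by apply: xget_unique => [|_ [->]//]; split=> // _ ->.
have E' x : dist x [set xs] = enorm (x - xs) by rewrite /dist image_set1 inf1.
by split=> -[g g0 h]; exists g => // x Xx; have := h _ Xx; rewrite E E'.
Qed.

(** The equivalence holds for each constant [g] separately.  The converse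
    direction passes to the limit along the segment from [xs] to [x], where
    the growth of [psi] bounds its derivative at [xs] from below; negating
    turns this into an instance of [is_derive_le]. *)
Lemma growth_dot_psi xs g : X xs ->
  (forall x, X x -> g * enorm (x - xs) <= dot (F xs) (x - xs)) <->
  (forall x, X x -> g * enorm (x - xs) <= psi theta a x xs).
Proof.
move=> Xxs; split=> h x Xx; first exact: le_trans (h _ Xx) (dot_le_psi Xx Xxs).
rewrite -lerN2; apply: (is_derive_le (is_deriveN (is_derive_psi xs (x - xs)))).
move=> t t0 t1; change (- psi theta a (t *: (x - xs) + xs) xs <=
  - psi theta a xs xs + t * - (g * enorm (x - xs))).
rewrite psixx oppr0 add0r mulrN lerN2.
have -> : t * (g * enorm (x - xs)) = g * enorm (t *: (x - xs) + xs - xs).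
  by rewrite addrK enormZ 1?ltW// mulrCA.
apply: h.
have -> : t *: (x - xs) + xs = t *: x + (1 - t) *: xs.
  by rewrite scalerBr scalerBl scale1r addrAC addrA.
exact: set_mem (X_convex (Itv01 (ltW t0) t1) (mem_set Xx) (mem_set Xxs)).
Qed.
End Game.

Theorem theorem4p1 (R : realType) (N : nat) (n : 'I_N -> nat)
    (X : set 'rV[R]_(\sum_(i < N) n i))
    (theta : 'I_N -> 'rV[R]_(\sum_(i < N) n i) -> R)
    (X_neq0 : X !=set0) (X_closed : closed X) (X_convex : convex_set X)
    (theta_C1 : forall i, continuously_differentiable (theta i))
    (theta_convex : forall (i : 'I_N) (x : 'rV[R]_(\sum_(i < N) n i)),
      convex_function setT
        (fun z : 'rV[R]_(n i) => theta i (with_strategy x z)))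
    (a : R) (a_gt0 : 0 < a)
    (psi_convex : forall y, X y ->
      convex_function X (fun x => psi theta a x y))
    (NNE_neq0 : NNE theta X !=set0) :
  weakly_sharp theta X <-> linearly_conditioned theta X a.
Proof.
have theta_diff i x : differentiable (theta i) x by case: (theta_C1 i).
have [xs Nxs] := NNE_neq0; have [Xxs _] := Nxs.
have wsP := weakly_sharpP theta_diff theta_convex a_gt0 psi_convex Nxs.
have lcP := linearly_conditionedP theta_diff theta_convex a_gt0 psi_convex Nxs.
have growthP g := growth_dot_psi theta_diff X_convex psi_convex g Xxs.
by split=> [/wsP|/lcP] [g g0 h]; [apply/lcP|apply/wsP];
  exists g => //; apply/growthP.
Qed.
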